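(* Let $R_s$, $R_c$ and $D(p,\kappa)$ be as in the context, let $0<L<\infty$, and let $p(z)>0$ and $\kappa(z)>0$, $z\in(0,L]$, be a power policy and a mismatch factor policy. Consider, for a real constant $\beta$, the equation $$D(p(z),\kappa(z))-\frac{\partial D}{\partial\kappa}(p(z),\kappa(z))\,\kappa(z)+\beta=0,\qquad z>0. \qquad(\ast)$$ The constant $\beta$ in $(\ast)$ must be in the range $\beta_{\min}<\beta<\beta_{\max}$, where $$\beta_{\max}:=\lim_{D\downarrow0}\frac{R_s(D)}{R_s'(D)},\qquad \beta_{\min}:=\lim_{D\uparrow D_{\max}}\frac{R_s(D)}{R_s'(D)}-D_{\max}.$$ Furthermore, for every such choice of $\beta$, equation $(\ast)$ results in a unique constant solution for the instantaneous distortion $D(p(z),\kappa(z))$, $z>0$; that is, $(\ast)$ determines $D(p(z),\kappa(z))$ uniquely, and its value does not depend on $z$ for $z>0$.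
   Context: Rate-distortion function: $R_s$ is a real-valued non-negative function of $D$, with thresholds $0<D_{\max}<\infty$ and $R_s^{\rm th}\in(0,\infty]$, such that [S1] $R_s(D)=0$ for $D\ge D_{\max}$; [S2] on $0<D<D_{\max}$, $R_s$ is strictly decreasing, convex and twice continuously differentiable with $R_s'(D)<0$ and $R_s''(D)>0$, and $R_s$ is continuous at $D_{\max}$; [S3] $\lim_{D\downarrow 0}R_s'(D)=-\infty$, and $R_s'$ is finite everywhere else; [S4] $\lim_{D\downarrow 0}R_s(D)=R_s^{\rm th}$, and if $R_s^{\rm th}<\infty$ then $R_s$ is right-continuous at $0$. Channel coding rate: $R_c:[0,\infty)\to[0,\infty)$ satisfies [C1] $R_c(p)>0$ for $p>0$, $R_c(0)=0$, and $R_c$ is right-continuous at $0$; [C2] on $p>0$, $R_c$ is strictly increasing, concave and twice continuously differentiable with $R_c'(p)>0$ and $R_c''(p)<0$. Distortion function: for $p\ge 0$ and $\kappa>0$, if $\kappa R_c(p)<R_s^{\rm th}$ then $D(p,\kappa)$ is the unique $D\in(0,D_{\max}]$ with $R_s(D)=\kappa R_c(p)$; if $R_s^{\rm th}<\infty$ and $\kappa R_c(p)\ge R_s^{\rm th}$ then $D(p,\kappa)=0$. Here $z\in[0,L]$ is the charge of a battery of capacity $L$; $p(z)$ is the transmission power and $\kappa(z)$ the number of channel uses per source symbol at charge $z$. Equation $(\ast)$ arises as a necessary condition for local optimality of the mismatch factor policy $\kappa$ when minimizing the long-term average distortion, $\beta$ being a free constant.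
   Formalization: The range claim for β gets one exception: if R_s^th is finite and D(p(z),κ(z)) = 0 for all z in (0,L], then (∗) holds with β = β_max = 0, so the strict bound β < β_max fails there; in every other case β_min < β < β_max is proved as stated. *)

(* Defs.v *)
(* Stdlib reals with Coquelicot. *)
From Stdlib Require Export Reals.
From Coquelicot Require Export Coquelicot.
Open Scope R_scope.

Definition strictly_decreasing_on (P : R -> Prop) (f : R -> R) : Prop :=
  forall x y, P x -> P y -> x < y -> f y < f x.

Definition strictly_increasing_on (P : R -> Prop) (f : R -> R) : Prop :=
  forall x y, P x -> P y -> x < y -> f x < f y.

Definition convex_on (P : R -> Prop) (f : R -> R) : Prop :=
  forall x y t, P x -> P y -> 0 <= t <= 1 ->
    f (t * x + (1 - t) * y) <= t * f x + (1 - t) * f y.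

Definition concave_on (P : R -> Prop) (f : R -> R) : Prop :=
  forall x y t, P x -> P y -> 0 <= t <= 1 ->
    t * f x + (1 - t) * f y <= f (t * x + (1 - t) * y).

Definition C2_on (P : R -> Prop) (f : R -> R) : Prop :=
  forall x, P x ->
    ex_derive f x /\ ex_derive (Derive f) x /\ continuous (Derive (Derive f)) x.

(* [Rs] is only constrained on (0, +oo), and also at 0 when [Rth] is finite. *)
Record rate_distortion (Rs : R -> R) (Dmax : R) (Rth : Rbar) : Prop := {
  rd_Dmax_pos : 0 < Dmax;
  rd_Rth_pos : Rbar_lt 0 Rth;
  rd_nonneg : forall D, 0 < D -> 0 <= Rs D;
  rd_zero : forall D, Dmax <= D -> Rs D = 0;
  rd_decr : strictly_decreasing_on (fun D => 0 < D < Dmax) Rs;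
  rd_convex : convex_on (fun D => 0 < D < Dmax) Rs;
  rd_C2 : C2_on (fun D => 0 < D < Dmax) Rs;
  rd_derive_neg : forall D, 0 < D < Dmax -> Derive Rs D < 0;
  rd_derive2_pos : forall D, 0 < D < Dmax -> 0 < Derive (Derive Rs) D;
  rd_cont_Dmax : continuous Rs Dmax;
  rd_derive_0 : filterlim (Derive Rs) (at_right 0) (Rbar_locally m_infty);
  (* Finiteness of Rs' away from 0 has content only at [Dmax], where [Rs] may
     have a corner: it is then the left-hand value of Rs' that is meant. *)
  rd_derive_Dmax : exists l : R, filterlim (Derive Rs) (at_left Dmax) (locally l);
  rd_lim_0 : filterlim Rs (at_right 0) (Rbar_locally Rth);
  rd_cont_0 : is_finite Rth -> filterlim Rs (at_right 0) (locally (Rs 0))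
}.

Record channel_rate (Rc : R -> R) : Prop := {
  cr_pos : forall p, 0 < p -> 0 < Rc p;
  cr_0 : Rc 0 = 0;
  cr_cont_0 : filterlim Rc (at_right 0) (locally (Rc 0));
  cr_incr : strictly_increasing_on (fun p => 0 < p) Rc;
  cr_concave : concave_on (fun p => 0 < p) Rc;
  cr_C2 : C2_on (fun p => 0 < p) Rc;
  cr_derive_pos : forall p, 0 < p -> 0 < Derive Rc p;
  cr_derive2_neg : forall p, 0 < p -> Derive (Derive Rc) p < 0
}.

(* [iota P] is the element satisfying [P] when there is exactly one
   ([iota_correct]). Only arguments p >= 0 and kappa > 0 are meaningful. *)
Definition distortion (Rs Rc : R -> R) (Dmax : R) (Rth : Rbar) (p kappa : R) : R :=
  if Rbar_lt_dec (kappa * Rc p) Rth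
  then iota (fun D : R => 0 < D <= Dmax /\ Rs D = kappa * Rc p)
  else 0.

Definition policy (L : R) (f : R -> R) : Prop :=
  forall z, 0 < z <= L -> 0 < f z.

(* The partial derivative is required to exist. *)
Definition stationarity (Rs Rc : R -> R) (Dmax : R) (Rth : Rbar)
    (beta p kappa : R) : Prop :=
  exists dD : R,
    is_derive (fun k => distortion Rs Rc Dmax Rth p k) kappa dD /\
    distortion Rs Rc Dmax Rth p kappa - dD * kappa + beta = 0.

Definition is_beta_max (Rs : R -> R) (b : R) : Prop :=
  filterlim (fun D => Rs D / Derive Rs D) (at_right 0) (locally b).

Definition is_beta_min (Rs : R -> R) (Dmax b : R) : Prop :=
  exists l : R,
    filterlim (fun D => Rs D / Derive Rs D) (at_left Dmax) (locally l) /\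
    b = l - Dmax.

(* Main.v *)
(* Differentiating [Rs (D p kappa) = kappa * Rc p] in [kappa] turns the
   stationarity equation, wherever [D > 0], into [h D = beta] with
   [h D = Rs D / Rs' D - D]: minus the point where the tangent to [Rs] at [D]
   meets the axis. Strict convexity makes [h] strictly decreasing, with
   [-Dmax < h D < -D], so [h] maps (0, Dmax) bijectively onto
   (beta_min, beta_max), where [beta_min = -Dmax] and [beta_max = sup h].
   Where [D = 0], the right derivative in [kappa] vanishes, which forces
   [beta = 0], and then [beta_max = 0] because [Rs <= Rth < +oo] while [Rs']
   tends to -oo. *)
Require Import Defs.
From Stdlib Require Import Reals Lra Ranalysis5.
From Coquelicot Require Import Coquelicot.
Open Scope R_scope.

(** * Mean value theorem and one-sided neighbourhoods *)

Lemma ex_derive_continuity_pt (f : R -> R) (x : R) :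
  ex_derive f x -> continuity_pt f x.
Proof.
intros hf; apply continuity_pt_filterlim.
exact (ex_derive_continuous f x hf).
Qed.

(** Differentiability is asked only inside the interval, so that the right end may be the corner of
    [Rs] at [Dmax]. *)
Lemma MVT_Derive (f : R -> R) (a b : R) :
  a < b -> (forall x, a < x < b -> ex_derive f x) ->
  (forall x, a <= x <= b -> continuity_pt f x) ->
  exists c, a < c < b /\ f b - f a = Derive f c * (b - a).
Proof.
intros hab hd hc.
assert (pr : forall c, a < c < b -> derivable_pt f c).
{ intros c hcab; apply ex_derive_Reals_0; now apply hd. }
destruct (MVT f id a b pr (fun c _ => derivable_pt_id c) hab hc)
  as [c [hcab e]].
{ intros c _; apply derivable_continuous_pt, derivable_pt_id. }
exists c; split; [exact hcab|].
rewrite derive_pt_id, Derive_Reals in e; unfold id in e; lra.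
Qed.

Lemma at_right_exists_lt (x d : R) (P : R -> Prop) :
  x < d -> at_right x P -> exists y, x < y < d /\ P y.
Proof.
intros hd [e he].
exists (x + Rmin (d - x) e / 2).
assert (h := cond_pos e).
assert (h1 := Rmin_l (d - x) e); assert (h2 := Rmin_r (d - x) e).
assert (h3 : 0 < Rmin (d - x) e) by (apply Rmin_glb_lt; lra).
split; [lra|].
apply he; [|lra].
unfold ball; simpl; unfold AbsRing_ball, abs, minus, plus, opp; simpl.
rewrite Rabs_pos_eq; lra.
Qed.

Lemma at_right_interval (x d : R) (P : R -> Prop) :
  x < d -> (forall y, x < y < d -> P y) -> at_right x P.
Proof.
intros hd hP.
assert (he : 0 < d - x) by lra.
exists (mkposreal _ he); intros y hy hxy; apply hP.
unfold ball in hy; simpl in hy.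
unfold AbsRing_ball, abs, minus, plus, opp in hy; simpl in hy.
apply Rabs_def2 in hy; lra.
Qed.

Lemma at_left_interval (x d : R) (P : R -> Prop) :
  d < x -> (forall y, d < y < x -> P y) -> at_left x P.
Proof.
intros hd hP.
assert (he : 0 < x - d) by lra.
exists (mkposreal _ he); intros y hy hxy; apply hP.
unfold ball in hy; simpl in hy.
unfold AbsRing_ball, abs, minus, plus, opp in hy; simpl in hy.
apply Rabs_def2 in hy; lra.
Qed.

(** The function [h] of the outline: the opposite of the Newton iterate of [f] at [x]. *)
Definition tangent_offset (f : R -> R) (x : R) : R := f x / Derive f x - x.

(** * Rate-distortion functions *)

Lemma rd_continuity_pt Rs Dmax Rth (h : rate_distortion Rs Dmax Rth) (D : R) :
  0 < D <= Dmax -> continuity_pt Rs D.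
Proof.
intros hD; destruct (Req_dec D Dmax) as [->|hne].
- apply continuity_pt_filterlim; exact (rd_cont_Dmax _ _ _ h).
- apply ex_derive_continuity_pt, (rd_C2 _ _ _ h); lra.
Qed.

Lemma rd_slope Rs Dmax Rth (h : rate_distortion Rs Dmax Rth) (x y : R) :
  0 < x < y -> y <= Dmax ->
  exists c, x < c < y /\ Rs y - Rs x = Derive Rs c * (y - x).
Proof.
intros hx hy; apply MVT_Derive; [lra| |].
- intros c hc; apply (rd_C2 _ _ _ h); lra.
- intros c hc; apply (rd_continuity_pt _ _ _ h); lra.
Qed.

Lemma rd_Derive_continuity_pt Rs Dmax Rth (h : rate_distortion Rs Dmax Rth)
    (D : R) :
  0 < D < Dmax -> continuity_pt (Derive Rs) D.
Proof.
intros hD; apply ex_derive_continuity_pt.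
now destruct (rd_C2 _ _ _ h D hD) as [_ [? _]].
Qed.

Lemma rd_Derive_incr Rs Dmax Rth (h : rate_distortion Rs Dmax Rth) (x y : R) :
  0 < x < y -> y < Dmax -> Derive Rs x < Derive Rs y.
Proof.
intros hx hy.
destruct (MVT_Derive (Derive Rs) x y) as [c [hc e]]; [lra| | |].
- intros c hc; apply (rd_C2 _ _ _ h); lra.
- intros c hc; apply (rd_Derive_continuity_pt _ _ _ h); lra.
- assert (h2 := rd_derive2_pos _ _ _ h c ltac:(lra)).
  assert (0 < Derive (Derive Rs) c * (y - x)) by (apply Rmult_lt_0_compat; lra).
  lra.
Qed.

(** Extends [rd_decr] to the closed end [Dmax], through the sign of the slope at an interior
    point. *)
Lemma rd_decr_le Rs Dmax Rth (h : rate_distortion Rs Dmax Rth) (x y : R) :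
  0 < x < y -> y <= Dmax -> Rs y < Rs x.
Proof.
intros hx hy; destruct (rd_slope _ _ _ h x y hx hy) as [c [hc e]].
assert (h1 := rd_derive_neg _ _ _ h c ltac:(lra)).
assert (0 < - Derive Rs c * (y - x)) by (apply Rmult_lt_0_compat; lra).
lra.
Qed.

Lemma rd_inj Rs Dmax Rth (h : rate_distortion Rs Dmax Rth) (x y : R) :
  0 < x <= Dmax -> 0 < y <= Dmax -> Rs x = Rs y -> x = y.
Proof.
intros hx hy e; destruct (Rtotal_order x y) as [hl|[he|hl]]; [|exact he|].
- assert (h1 := rd_decr_le _ _ _ h x y ltac:(lra) ltac:(lra)); lra.
- assert (h1 := rd_decr_le _ _ _ h y x ltac:(lra) ltac:(lra)); lra.
Qed.

Lemma rd_at_Dmax Rs Dmax Rth (h : rate_distortion Rs Dmax Rth) : Rs Dmax = 0.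
Proof. apply (rd_zero _ _ _ h); lra. Qed.

Lemma rd_pos Rs Dmax Rth (h : rate_distortion Rs Dmax Rth) (D : R) :
  0 < D < Dmax -> 0 < Rs D.
Proof.
intros hD; rewrite <- (rd_at_Dmax _ _ _ h).
apply (rd_decr_le _ _ _ h); lra.
Qed.

(** A decreasing function stays below its limit at 0. This gives a weak inequality at [D / 2], and
    the strict decrease from [D / 2] to [D] makes it strict. *)
Lemma rd_lt_Rth Rs Dmax Rth (h : rate_distortion Rs Dmax Rth) (D : R) :
  0 < D < Dmax -> Rbar_lt (Rs D) Rth.
Proof.
intros hD.
assert (hle : Rbar_le (Rs (D / 2)) Rth).
{ apply Rbar_not_lt_le; intros hlt.
  assert (hs := rd_lim_0 _ _ _ h _ (open_Rbar_lt' _ _ hlt)).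
  destruct (at_right_exists_lt 0 (D / 2) _ ltac:(lra) hs) as [x [hx hx']].
  simpl in hx'.
  assert (h1 := rd_decr_le _ _ _ h x (D / 2) ltac:(lra) ltac:(lra)); lra. }
apply Rbar_lt_le_trans with (2 := hle); simpl.
apply (rd_decr_le _ _ _ h); lra.
Qed.

Lemma rd_surj Rs Dmax Rth (h : rate_distortion Rs Dmax Rth) (y : R) :
  0 < y -> Rbar_lt y Rth -> exists D, 0 < D < Dmax /\ Rs D = y.
Proof.
intros hy hlt.
assert (hD := rd_Dmax_pos _ _ _ h); assert (h0 := rd_at_Dmax _ _ _ h).
assert (hs := rd_lim_0 _ _ _ h _ (open_Rbar_gt' _ _ hlt)).
destruct (at_right_exists_lt 0 Dmax _ hD hs) as [x [hx hx']]; simpl in hx'.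
(* [IVT_interv] wants a change of sign from negative to positive, hence [y - Rs D]. It returns a
   point of the closed interval, and [Dmax] is excluded at the end because [Rs Dmax = 0 < y]. *)
destruct (IVT_interv (fun D => y - Rs D) x Dmax) as [D [hD' e]].
- intros D hD'; apply continuity_pt_minus.
  + apply continuity_pt_const; intros u v; reflexivity.
  + apply (rd_continuity_pt _ _ _ h); lra.
- lra.
- lra.
- rewrite h0; lra.
- exists D; split; [|lra].
  destruct (Req_dec D Dmax) as [->|hne]; lra.
Qed.

(** * The tangent offset: monotonicity, bounds, limits at both ends, range *)

(** The offset is not differentiated. Replacing [Rs' y] by the steeper [Rs' x] under [Rs y]
    increases the quotient; the remaining difference is [m / a * (y - x)], where the secant slope
    [m] is less steep than [a = Rs' x], so it is below [y - x]. *)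
Lemma tangent_offset_decr Rs Dmax Rth (h : rate_distortion Rs Dmax Rth)
    (x y : R) :
  0 < x < y -> y < Dmax -> tangent_offset Rs y < tangent_offset Rs x.
Proof.
intros hx hy; unfold tangent_offset.
assert (hp := rd_pos _ _ _ h y ltac:(lra)).
destruct (rd_slope _ _ _ h x y hx ltac:(lra)) as [c [hc e]].
assert (hxc := rd_Derive_incr _ _ _ h x c ltac:(lra) ltac:(lra)).
assert (hcy := rd_Derive_incr _ _ _ h c y ltac:(lra) ltac:(lra)).
assert (hny := rd_derive_neg _ _ _ h y ltac:(lra)).
set (a := Derive Rs x) in *; set (b := Derive Rs y) in *;
  set (m := Derive Rs c) in *.
assert (h1 : Rs y / b < Rs y / a).
{ apply Rmult_lt_compat_l; [exact hp|].
  apply Ropp_lt_cancel; rewrite <- !Rinv_opp.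
  apply Rinv_lt_contravar; [apply Rmult_lt_0_compat|]; lra. }
assert (h2 : Rs y / a - Rs x / a = m / a * (y - x)).
{ unfold Rdiv; rewrite <- Rmult_minus_distr_r, e; ring. }
assert (h3 : m / a < 1).
{ apply Rmult_lt_reg_r with (- a); [lra|].
  replace (m / a * - a) with (- m) by (field; lra); lra. }
assert (m / a * (y - x) < 1 * (y - x)) by (apply Rmult_lt_compat_r; lra).
lra.
Qed.

(** By strict convexity the tangent at [D] is steeper than the chord from [D] to [Dmax], so it meets
    the axis before [Dmax]; as [Rs D > 0] and the slope is negative, it meets it after [D]. *)
Lemma tangent_offset_bounds Rs Dmax Rth (h : rate_distortion Rs Dmax Rth)
    (D : R) :
  0 < D < Dmax -> - Dmax < tangent_offset Rs D < - D.
Proof.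
intros hD; unfold tangent_offset.
assert (hp := rd_pos _ _ _ h D hD); assert (h0 := rd_at_Dmax _ _ _ h).
destruct (rd_slope _ _ _ h D Dmax ltac:(lra) ltac:(lra)) as [c [hc e]].
assert (hDc := rd_Derive_incr _ _ _ h D c ltac:(lra) ltac:(lra)).
assert (hn := rd_derive_neg _ _ _ h D hD).
assert (hs : Rs D / Derive Rs D * - Derive Rs D = - Rs D) by (field; lra).
split.
- apply Rplus_lt_reg_r with D.
  apply Rmult_lt_reg_r with (- Derive Rs D); [lra|].
  replace ((Rs D / Derive Rs D - D + D) * - Derive Rs D) with (- Rs D) by lra.
  assert ((Derive Rs c - Derive Rs D) * (Dmax - D) > 0)
    by (apply Rmult_lt_0_compat; lra).
  nra.
- apply Rplus_lt_reg_r with D.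
  apply Rmult_lt_reg_r with (- Derive Rs D); [lra|].
  replace ((Rs D / Derive Rs D - D + D) * - Derive Rs D) with (- Rs D) by lra.
  lra.
Qed.

(** The bounds squeeze [Rs D / Rs' D] between [D - Dmax] and 0, which also settles the form 0/0 when
    [Rs'] tends to 0 at [Dmax]. *)
Lemma is_beta_min_opp_Dmax Rs Dmax Rth
    (h : rate_distortion Rs Dmax Rth) :
  is_beta_min Rs Dmax (- Dmax).
Proof.
assert (hD := rd_Dmax_pos _ _ _ h).
exists 0; split; [|ring].
apply filterlim_locally; intros eps; assert (he := cond_pos eps).
apply at_left_interval with (Rmax 0 (Dmax - eps)).
{ apply Rmax_lub_lt; lra. }
intros D hDm.
assert (h1 := Rmax_l 0 (Dmax - eps)); assert (h2 := Rmax_r 0 (Dmax - eps)).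
assert (h3 := tangent_offset_bounds _ _ _ h D ltac:(lra)).
unfold tangent_offset in h3.
unfold ball; simpl; unfold AbsRing_ball, abs, minus, plus, opp; simpl.
apply Rabs_def1; lra.
Qed.

Definition tangent_offset_range (Rs : R -> R) (Dmax y : R) : Prop :=
  exists D, 0 < D < Dmax /\ y = tangent_offset Rs D.

(** Provides [beta_max] as a supremum, bounded above by 0; that it is the required limit is shown
    afterwards. *)
Lemma tangent_offset_lub Rs Dmax Rth (h : rate_distortion Rs Dmax Rth) :
  exists b, is_lub (tangent_offset_range Rs Dmax) b.
Proof.
assert (hD := rd_Dmax_pos _ _ _ h).
destruct (completeness (tangent_offset_range Rs Dmax)) as [b hb].
- exists 0; intros y [D [hD' ->]].
  assert (h1 := tangent_offset_bounds _ _ _ h D hD'); lra.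
- exists (tangent_offset Rs (Dmax / 2)), (Dmax / 2); split; [lra|reflexivity].
- now exists b.
Qed.

(** The supremum is not attained: the value at [D / 2] is already larger than the one at [D]. *)
Lemma tangent_offset_lt_lub Rs Dmax Rth (h : rate_distortion Rs Dmax Rth)
    (b D : R) :
  is_lub (tangent_offset_range Rs Dmax) b ->
  0 < D < Dmax -> tangent_offset Rs D < b.
Proof.
intros [hub _] hD.
apply Rlt_le_trans with (tangent_offset Rs (D / 2)).
- apply (tangent_offset_decr _ _ _ h); lra.
- apply hub; exists (D / 2); split; [lra|reflexivity].
Qed.

Lemma tangent_offset_near_lub Rs Dmax (b c : R) :
  is_lub (tangent_offset_range Rs Dmax) b -> c < b ->
  exists D, 0 < D < Dmax /\ c < tangent_offset Rs D.
Proof.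
intros [_ hleast] hc.
destruct (Classical_Prop.classic (exists D, 0 < D < Dmax /\ c < tangent_offset Rs D))
  as [hex|hno]; [exact hex|].
assert (hbc : b <= c); [|lra].
apply hleast; intros y [D [hD ->]].
apply Rnot_lt_le; intros hlt; apply hno; now exists D.
Qed.

Lemma is_beta_max_lub Rs Dmax Rth
    (h : rate_distortion Rs Dmax Rth) (b : R) :
  is_lub (tangent_offset_range Rs Dmax) b -> is_beta_max Rs b.
Proof.
intros hb; apply filterlim_locally; intros eps; assert (he := cond_pos eps).
destruct (tangent_offset_near_lub _ _ b (b - eps) hb ltac:(lra))
  as [D [hD hlt]].
(* Below [D] the offset is within [eps] of its supremum; below [eps] the term [x] separating it from
   [Rs x / Rs' x] is harmless. *)
apply at_right_interval with (Rmin D eps).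
{ apply Rmin_glb_lt; lra. }
intros x hx.
assert (h1 := Rmin_l D eps); assert (h2 := Rmin_r D eps).
assert (h3 := tangent_offset_decr _ _ _ h x D ltac:(lra) ltac:(lra)).
assert (h4 := tangent_offset_lt_lub _ _ _ h b x hb ltac:(lra)).
unfold tangent_offset at 2 in h3; unfold tangent_offset in h4.
unfold ball; simpl; unfold AbsRing_ball, abs, minus, plus, opp; simpl.
apply Rabs_def1; lra.
Qed.

Lemma tangent_offset_lub_finite Rs Dmax Rth
    (h : rate_distortion Rs Dmax Rth) (b : R) :
  is_finite Rth -> is_lub (tangent_offset_range Rs Dmax) b -> b = 0.
Proof.
intros hfin hb.
assert (hD := rd_Dmax_pos _ _ _ h).
assert (hpos := rd_Rth_pos _ _ _ h); rewrite <- hfin in hpos; simpl in hpos.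
destruct (Rtotal_order b 0) as [hneg|[e|hgt]]; [|exact e|].
(* If [b < 0], then [Rs x / Rs' x < b / 2] for [x < - b / 2]; with [Rs' x < 2 * Rth / b] this would
   give [Rs x > Rth]. *)
- assert (hs := rd_derive_0 _ _ _ h _ (open_Rbar_lt' m_infty (2 * Rth / b) I)).
  destruct (at_right_exists_lt 0 (Rmin Dmax (- b / 2)) _
              ltac:(apply Rmin_glb_lt; lra) hs) as [x [hx hx']].
  simpl in hx'.
  assert (h1 := Rmin_l Dmax (- b / 2)); assert (h2 := Rmin_r Dmax (- b / 2)).
  assert (h3 := tangent_offset_lt_lub _ _ _ h b x hb ltac:(lra)).
  assert (h4 := rd_lt_Rth _ _ _ h x ltac:(lra)).
  rewrite <- hfin in h4; simpl in h4.
  assert (hn := rd_derive_neg _ _ _ h x ltac:(lra)).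
  unfold tangent_offset in h3.
  assert (h5 : Rs x / Derive Rs x < b / 2) by lra.
  apply Rmult_lt_compat_r with (r := - Derive Rs x) in h5; [|lra].
  replace (Rs x / Derive Rs x * - Derive Rs x) with (- Rs x) in h5
    by (field; lra).
  apply Rmult_lt_compat_r with (r := - b / 2) in hx'; [|lra].
  replace (2 * Rth / b * (- b / 2)) with (- Rth) in hx' by (field; lra).
  lra.
- destruct (tangent_offset_near_lub _ _ b 0 hb hgt) as [D [hD' hlt]].
  assert (h1 := tangent_offset_bounds _ _ _ h D hD'); lra.
Qed.

Lemma tangent_offset_surj Rs Dmax Rth (h : rate_distortion Rs Dmax Rth)
    (b beta : R) :
  is_lub (tangent_offset_range Rs Dmax) b -> - Dmax < beta < b ->
  exists D, 0 < D < Dmax /\ tangent_offset Rs D = beta.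
Proof.
intros hb hbeta.
destruct (tangent_offset_near_lub _ _ b beta hb ltac:(lra)) as [x [hx hlt]].
(* Any [y] beyond [- beta] works, since the offset there is below [- y]; the midpoint with [Dmax]
   also stays to the right of [x]. *)
assert (hy : exists y, x < y < Dmax /\ tangent_offset Rs y < beta).
{ exists ((Rmax x (- beta) + Dmax) / 2).
  assert (h1 := Rmax_l x (- beta)); assert (h2 := Rmax_r x (- beta)).
  assert (h3 : Rmax x (- beta) < Dmax) by (apply Rmax_lub_lt; lra).
  split; [lra|].
  assert (h4 := tangent_offset_bounds _ _ _ h
                  ((Rmax x (- beta) + Dmax) / 2) ltac:(lra)); lra. }
destruct hy as [y [hy hylt]].
destruct (IVT_interv (fun D => beta - tangent_offset Rs D) x y)
  as [D [hD e]]; try lra.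
- intros D hD; apply continuity_pt_minus.
  { apply continuity_pt_const; intros u v; reflexivity. }
  apply continuity_pt_minus; [|apply continuity_pt_id].
  apply continuity_pt_div.
  + apply (rd_continuity_pt _ _ _ h); lra.
  + apply (rd_Derive_continuity_pt _ _ _ h); lra.
  + assert (hn := rd_derive_neg _ _ _ h D ltac:(lra)); lra.
- exists D; lra.
Qed.

Lemma tangent_offset_inj Rs Dmax Rth (h : rate_distortion Rs Dmax Rth)
    (x y : R) :
  0 < x < Dmax -> 0 < y < Dmax ->
  tangent_offset Rs x = tangent_offset Rs y -> x = y.
Proof.
intros hx hy e; destruct (Rtotal_order x y) as [hl|[he|hl]]; [|exact he|].
- assert (h1 := tangent_offset_decr _ _ _ h x y ltac:(lra) ltac:(lra)); lra.
- assert (h1 := tangent_offset_decr _ _ _ h y x ltac:(lra) ltac:(lra)); lra.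
Qed.

(** * The distortion function *)

(** The only evaluation of [iota]; afterwards a positive distortion is handled through the equation
    [Rs D = kappa * Rc p]. *)
Lemma distortion_eq Rs Rc Dmax Rth (h : rate_distortion Rs Dmax Rth)
    (p kappa D : R) :
  0 < D < Dmax -> Rs D = kappa * Rc p -> distortion Rs Rc Dmax Rth p kappa = D.
Proof.
intros hD e; unfold distortion.
assert (hlt := rd_lt_Rth _ _ _ h D hD); rewrite e in hlt.
destruct (Rbar_lt_dec _ _) as [_|hn]; [|contradiction].
apply (@iota_unique R_AbsRing R_CompleteNormedModule).
- intros D' [hD' e']; apply (rd_inj _ _ _ h); lra.
- split; [lra|exact e].
Qed.

Lemma distortion_interior Rs Rc Dmax Rth (h : rate_distortion Rs Dmax Rth)
    (p kappa : R) :
  0 < kappa * Rc p -> Rbar_lt (kappa * Rc p) Rth ->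
  0 < distortion Rs Rc Dmax Rth p kappa < Dmax /\
  Rs (distortion Rs Rc Dmax Rth p kappa) = kappa * Rc p.
Proof.
intros hp hlt; destruct (rd_surj _ _ _ h _ hp hlt) as [D [hD e]].
now rewrite (distortion_eq _ _ _ _ h p kappa D hD e).
Qed.

Lemma distortion_saturated Rs Rc Dmax Rth (p kappa : R) :
  ~ Rbar_lt (kappa * Rc p) Rth -> distortion Rs Rc Dmax Rth p kappa = 0.
Proof. intros hn; unfold distortion; now destruct (Rbar_lt_dec _ _). Qed.

(** Inverse function rule, proved by hand: the difference quotient equals [Rc p / Rs' c] for some
    [c] near [D], and [Rs'] is continuous at [D]. *)
Lemma distortion_is_derive Rs Rc Dmax Rth (h : rate_distortion Rs Dmax Rth)
    (p kappa : R) :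
  let D := distortion Rs Rc Dmax Rth p kappa in
  0 < Rc p -> 0 < D < Dmax -> Rs D = kappa * Rc p ->
  is_derive (fun k => distortion Rs Rc Dmax Rth p k) kappa (Rc p / Derive Rs D).
Proof.
intros D hc hD e.
assert (hn := rd_derive_neg _ _ _ h D hD).
apply is_derive_Reals; intros eps heps.
assert (hcont : continuity_pt (fun x => Rc p / Derive Rs x) D).
{ apply continuity_pt_div.
  - apply continuity_pt_const; intros u v; reflexivity.
  - now apply (rd_Derive_continuity_pt _ _ _ h).
  - lra. }
rewrite continuity_pt_locally in hcont.
destruct (hcont (mkposreal eps heps)) as [r hr]; simpl in hr.
assert (hr0 := cond_pos r).
(* The window of radius [s] around [D] stays inside (0, [Dmax]) and inside the radius [r] of
   continuity. *)
set (s := Rmin (r / 2) (Rmin (D / 2) ((Dmax - D) / 2))).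
assert (hs : 0 < s /\ s <= r / 2 /\ s <= D / 2 /\ s <= (Dmax - D) / 2).
{ unfold s.
  assert (h1 := Rmin_l (r / 2) (Rmin (D / 2) ((Dmax - D) / 2))).
  assert (h2 := Rmin_r (r / 2) (Rmin (D / 2) ((Dmax - D) / 2))).
  assert (h3 := Rmin_l (D / 2) ((Dmax - D) / 2)).
  assert (h4 := Rmin_r (D / 2) ((Dmax - D) / 2)).
  repeat split; try lra.
  repeat apply Rmin_glb_lt; lra. }
clearbody s; destruct hs as [hs0 [hsr [hsD hsM]]].
assert (hlo := rd_decr_le _ _ _ h (D - s) D ltac:(lra) ltac:(lra)).
assert (hhi := rd_decr_le _ _ _ h D (D + s) ltac:(lra) ltac:(lra)).
assert (hpos := rd_pos _ _ _ h (D + s) ltac:(lra)).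
(* A change of [kappa] by less than [d] keeps [kappa * Rc p] strictly between [Rs (D + s)] and
   [Rs (D - s)], so the new distortion [E] stays in the window. *)
set (d := Rmin (Rs (D - s) - Rs D) (Rs D - Rs (D + s)) / Rc p).
assert (hd : 0 < d /\ d * Rc p <= Rs (D - s) - Rs D /\
             d * Rc p <= Rs D - Rs (D + s)).
{ unfold d; unfold Rdiv; rewrite Rmult_assoc, Rinv_l, Rmult_1_r by lra.
  split; [|split; [apply Rmin_l|apply Rmin_r]].
  apply Rmult_lt_0_compat; [apply Rmin_glb_lt; lra|].
  now apply Rinv_0_lt_compat. }
clearbody d; destruct hd as [hd0 [hd1 hd2]].
exists (mkposreal d hd0); simpl; intros t ht htd.
apply Rabs_def2 in htd.
assert (ht1 : t * Rc p < d * Rc p) by (apply Rmult_lt_compat_r; lra).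
assert (ht2 : - d * Rc p < t * Rc p) by (apply Rmult_lt_compat_r; lra).
destruct (distortion_interior Rs Rc Dmax Rth h p (kappa + t)) as [hE eE].
{ lra. }
{ apply Rbar_lt_trans with (Rs (D - s)); [simpl; lra|].
  apply (rd_lt_Rth _ _ _ h); lra. }
set (E := distortion Rs Rc Dmax Rth p (kappa + t)) in *.
fold D.
assert (hE1 : D - s < E).
{ apply Rnot_le_lt; intros [hle|hle]; [|rewrite hle in eE; lra].
  assert (h1 := rd_decr_le _ _ _ h E (D - s) ltac:(lra) ltac:(lra)); lra. }
assert (hE2 : E < D + s).
{ apply Rnot_le_lt; intros [hle|hle]; [|rewrite <- hle in eE; lra].
  assert (h1 := rd_decr_le _ _ _ h (D + s) E ltac:(lra) ltac:(lra)); lra. }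
(* The product form treats both orders of [E] and [D] alike; when [E = D] both sides vanish. *)
assert (hc0 : exists c, D - s < c < D + s /\ Derive Rs c * (E - D) = t * Rc p).
{ destruct (Rtotal_order E D) as [hl|[he|hl]].
  - destruct (rd_slope _ _ _ h E D ltac:(lra) ltac:(lra)) as [c [hc' e']].
    exists c; split; lra.
  - exists D; rewrite he in eE |- *; split; lra.
  - destruct (rd_slope _ _ _ h D E ltac:(lra) ltac:(lra)) as [c [hc' e']].
    exists c; split; lra. }
destruct hc0 as [c [hcs ec]].
assert (hnc := rd_derive_neg _ _ _ h c ltac:(lra)).
replace ((E - D) / t) with (Rc p / Derive Rs c).
- apply hr; change (Rabs (c - D) < r); apply Rabs_def1; lra.
- apply Rmult_eq_reg_r with (t * Derive Rs c).
  + field_simplify; [|lra|lra]; lra.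
  + apply Rmult_integral_contrapositive_currified; lra.
Qed.

(** * The stationarity equation, below and at saturation *)

(** The derivative in [stationarity] must be [Rc p / Rs' D]; multiplied by [kappa] it becomes
    [Rs D / Rs' D], because [kappa * Rc p = Rs D]. *)
Lemma stationarity_interior Rs Rc Dmax Rth (h : rate_distortion Rs Dmax Rth)
    (beta p kappa : R) :
  let D := distortion Rs Rc Dmax Rth p kappa in
  0 < Rc p -> 0 < D < Dmax -> Rs D = kappa * Rc p ->
  stationarity Rs Rc Dmax Rth beta p kappa <-> tangent_offset Rs D = beta.
Proof.
intros D hc hD e.
assert (hder := distortion_is_derive Rs Rc Dmax Rth h p kappa hc hD e).
fold D in hder.
assert (hn := rd_derive_neg _ _ _ h D hD).
assert (ek : Rc p / Derive Rs D * kappa = Rs D / Derive Rs D)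
  by (rewrite e; field; lra).
unfold tangent_offset; split.
- intros [dD [hdD es]]; fold D in es.
  apply is_derive_unique in hdD; apply is_derive_unique in hder.
  rewrite hdD in hder; rewrite hder, ek in es; lra.
- intros eb; exists (Rc p / Derive Rs D); split; [exact hder|].
  fold D; rewrite ek; lra.
Qed.

(** The distortion is 0 at [kappa] and to its right, so an existing derivative must be 0. Looking
    only to the right covers the boundary [kappa * Rc p = Rth] as well. *)
Lemma stationarity_saturated Rs Rc Dmax Rth (beta p kappa : R) :
  0 < Rc p -> ~ Rbar_lt (kappa * Rc p) Rth ->
  stationarity Rs Rc Dmax Rth beta p kappa -> beta = 0.
Proof.
intros hc hn [dD [hd e]].
rewrite (distortion_saturated _ _ _ _ _ _ hn) in e.
assert (hsat : forall t, 0 < t -> distortion Rs Rc Dmax Rth p (kappa + t) = 0).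
{ intros t ht; apply distortion_saturated; intros hlt; apply hn.
  apply Rbar_lt_trans with (2 := hlt); simpl.
  apply Rmult_lt_compat_r; lra. }
assert (hd0 : dD = 0).
{ destruct (Req_dec dD 0) as [e0|hne]; [exact e0|exfalso].
  apply is_derive_Reals in hd.
  assert (habs := Rabs_pos_lt dD hne).
  (* With tolerance [Rabs dD], the zero quotient at the positive increment [r / 2] gives
     [Rabs dD < Rabs dD]. *)
  destruct (hd _ habs) as [r hr]; assert (hr0 := cond_pos r).
  assert (h1 := hr (r / 2) ltac:(lra) ltac:(rewrite Rabs_pos_eq; lra)).
  rewrite (distortion_saturated _ _ _ _ _ _ hn), hsat in h1 by lra.
  replace ((0 - 0) / (r / 2) - dD) with (- dD) in h1 by (field; lra).
  rewrite Rabs_Ropp in h1; lra. }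
rewrite hd0 in e; lra.
Qed.

(** The second alternative does occur: if [kappa * Rc p] exceeds a finite [Rth], the distortion
    vanishes near [kappa] and the equation holds with [beta = 0], which is then [b]. *)
Lemma stationarity_cases Rs Rc Dmax Rth (h : rate_distortion Rs Dmax Rth)
    (hRc : channel_rate Rc) (b beta p kappa : R) :
  let D := distortion Rs Rc Dmax Rth p kappa in
  is_lub (tangent_offset_range Rs Dmax) b -> 0 < p -> 0 < kappa ->
  stationarity Rs Rc Dmax Rth beta p kappa ->
  (- Dmax < beta < b /\ 0 < D < Dmax /\ tangent_offset Rs D = beta) \/
  (is_finite Rth /\ beta = b /\ D = 0).
Proof.
intros D hb hp hk hst; assert (hc := cr_pos _ hRc p hp).
destruct (Rbar_lt_dec (kappa * Rc p) Rth) as [hlt|hn].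
- left.
  destruct (distortion_interior Rs Rc Dmax Rth h p kappa) as [hD eR];
    [now apply Rmult_lt_0_compat|exact hlt|fold D in hD, eR].
  assert (e : tangent_offset Rs D = beta)
    by now apply (stationarity_interior Rs Rc Dmax Rth h beta p kappa).
  assert (h1 := tangent_offset_bounds _ _ _ h D hD).
  assert (h2 := tangent_offset_lt_lub _ _ _ h b D hb hD).
  rewrite e in h1, h2; repeat split; lra.
- right.
  assert (hfin : is_finite Rth).
  { assert (hpos := rd_Rth_pos _ _ _ h).
    destruct Rth as [r| |]; simpl in *; [reflexivity|now elim hn|easy]. }
  split; [exact hfin|split].
  + rewrite (tangent_offset_lub_finite _ _ _ h b hfin hb).
    now apply (stationarity_saturated Rs Rc Dmax Rth beta p kappa).
  + now apply distortion_saturated.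
Qed.

(** * The range of [beta] and the constant distortion *)

Theorem lemma2 (Rs Rc : R -> R) (Dmax : R) (Rth : Rbar) (L : R)
  (hRs : rate_distortion Rs Dmax Rth) (hRc : channel_rate Rc) (hL : 0 < L) :
  exists beta_min beta_max : R,
    is_beta_min Rs Dmax beta_min /\ is_beta_max Rs beta_max /\
    (forall (p kappa : R -> R) (beta : R),
       policy L p -> policy L kappa ->
       (forall z, 0 < z <= L ->
          stationarity Rs Rc Dmax Rth beta (p z) (kappa z)) ->
       beta_min < beta < beta_max \/
       (is_finite Rth /\ beta = beta_max /\
        forall z, 0 < z <= L -> distortion Rs Rc Dmax Rth (p z) (kappa z) = 0)) /\
    (forall beta : R, beta_min < beta < beta_max ->
       exists! Dstar : R,
         (forall p kappa : R -> R, policy L p -> policy L kappa ->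
            forall z, 0 < z <= L ->
              (stationarity Rs Rc Dmax Rth beta (p z) (kappa z) <->
               distortion Rs Rc Dmax Rth (p z) (kappa z) = Dstar)) /\
         (forall p : R -> R, policy L p ->
            exists kappa : R -> R, policy L kappa /\
              forall z, 0 < z <= L ->
                stationarity Rs Rc Dmax Rth beta (p z) (kappa z))).
Proof.
destruct (tangent_offset_lub _ _ _ hRs) as [b hb].
exists (- Dmax), b.
split; [exact (is_beta_min_opp_Dmax _ _ _ hRs)|].
split; [exact (is_beta_max_lub _ _ _ hRs b hb)|].
split.
- intros p kappa beta hp hk hst.
  destruct (Classical_Prop.classic (- Dmax < beta < b)) as [hin|hout];
    [now left|right].
  assert (hz : forall z, 0 < z <= L ->
            is_finite Rth /\ beta = b /\
            distortion Rs Rc Dmax Rth (p z) (kappa z) = 0).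
  { intros z hz.
    destruct (stationarity_cases _ _ _ _ hRs hRc b beta (p z) (kappa z)
                hb (hp z hz) (hk z hz) (hst z hz)) as [[hr _]|hs];
      [contradiction|exact hs]. }
  (* The facts independent of [z] are read off at [z = L]. *)
  destruct (hz L ltac:(lra)) as [hf [e _]].
  split; [exact hf|split; [exact e|]].
  intros z hz'; now apply hz.
- intros beta hbeta.
  destruct (tangent_offset_surj _ _ _ hRs b beta hb hbeta) as [D [hD e]].
  (* Pointwise form of the equivalence. Saturation is ruled out in one direction by [beta < b], in
     the other by [D > 0]. *)
  assert (hchar : forall p kappa, 0 < p -> 0 < kappa ->
            stationarity Rs Rc Dmax Rth beta p kappa <->
            distortion Rs Rc Dmax Rth p kappa = D).
  { intros p kappa hp hk; split.
    - intros hst.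
      destruct (stationarity_cases _ _ _ _ hRs hRc b beta p kappa hb hp hk hst)
        as [[_ [hD' e']]|[_ [e' _]]]; [|lra].
      apply (tangent_offset_inj _ _ _ hRs); [exact hD'|exact hD|lra].
    - intros e'.
      assert (hc := cr_pos _ hRc p hp).
      destruct (Rbar_lt_dec (kappa * Rc p) Rth) as [hlt|hn].
      + destruct (distortion_interior Rs Rc Dmax Rth hRs p kappa) as [hD' eR];
          [now apply Rmult_lt_0_compat|exact hlt|].
        apply stationarity_interior; try assumption.
        now rewrite e'.
      + rewrite (distortion_saturated _ _ _ _ _ _ hn) in e'; lra. }
  assert (hex : forall p, policy L p ->
            exists kappa, policy L kappa /\
              forall z, 0 < z <= L ->
                stationarity Rs Rc Dmax Rth beta (p z) (kappa z)).
  (* This [kappa] makes [kappa * Rc p] equal to [Rs D], so the distortion is [D] at every charge. *)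
  { intros p hp; exists (fun z => Rs D / Rc (p z)).
    assert (hk : policy L (fun z => Rs D / Rc (p z))).
    { intros z hz; apply Rdiv_lt_0_compat.
      - now apply (rd_pos _ _ _ hRs).
      - now apply (cr_pos _ hRc), hp. }
    split; [exact hk|intros z hz].
    assert (hc := cr_pos _ hRc (p z) (hp z hz)).
    apply hchar; [now apply hp|now apply hk|].
    apply (distortion_eq _ _ _ _ hRs _ _ _ hD); field; lra. }
  exists D; split; [split; [|exact hex]|].
  + intros p kappa hp hk z hz; apply hchar; [now apply hp|now apply hk].
  (* The equivalence alone could hold vacuously for a value that is never reached. A stationary
     pair, built here for constant power 1, has distortion both [D] and [D'] at [z = L]. *)
  + intros D' [hD' _].
    assert (hp : policy L (fun _ => 1)) by (intros z _; lra).
    destruct (hex _ hp) as [kappa [hk hst]].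
    assert (hz : 0 < L <= L) by lra.
    rewrite <- (proj1 (hD' _ _ hp hk L hz) (hst L hz)).
    symmetry; apply hchar; [lra|now apply hk|now apply hst].
Qed.
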